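(* The following algorithm computes the Cholesky factor $L$ of a given $d\times d$ block homogeneous correlation matrix $P$ with $S$ groups of sizes $d_1,\dots,d_S$, $d=d_1+\cdots+d_S$. 1) Set $\overline P(1)=P$. 2) For $s=1,\dots,S$ and $\overline P(s)$ of the form $$\overline P(s)=\begin{pmatrix}P^{(s)}_{1,1}&\cdots&P^{(s)}_{1,S-s+1}\\ \vdots&\ddots&\vdots\\ P^{(s)}_{S-s+1,1}&\cdots&P^{(s)}_{S-s+1,S-s+1}\end{pmatrix},$$ where, for $s_1,s_2\in\{1,\dots,S-s+1\}$, $P^{(s)}_{s_1,s_2}=\Gamma_{d_{s+t-1}}(\rho^{(s)}_t,\rho^{(s)}_{t,o})$ if $s_1=s_2=t$ and $P^{(s)}_{s_1,s_2}=\rho^{(s)}_{s_1,s_2}J_{d_{s+s_1-1}d_{s+s_2-1}}$ if $s_1\ne s_2$, for some diagonal entries of diagonal blocks $\rho^{(s)}_t$, off-diagonal entries of diagonal blocks $\rho^{(s)}_{t,o}$ and entries of off-diagonal blocks $\rho^{(s)}_{s_1,s_2}$, do the following. 2.1) Set $$L_{ss}=\begin{pmatrix}\tilde l_{ss,1}&0&0&\cdots&0\\ l_{ss,1}&\tilde l_{ss,2}&0&&\vdots\\ l_{ss,1}&l_{ss,2}&\tilde l_{ss,3}&\ddots&\vdots\\ \vdots&\vdots&\vdots&\ddots&0\\ l_{ss,1}&l_{ss,2}&l_{ss,3}&\cdots&\tilde l_{ss,d_s}\end{pmatrix}\in\mathbb{R}^{d_s\times d_s},$$ where $$\tilde l_{ss,j}=\sqrt{\rho_1^{(s)}-\sum_{k=1}^{j-1}l_{ss,k}^2}\quad\text{and}\quad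 l_{ss,j}=\frac{1}{\tilde l_{ss,j}}\Bigl(\rho_{1,o}^{(s)}-\sum_{k=1}^{j-1}l_{ss,k}^2\Bigr),\quad j=1,\dots,d_s.$$ 2.2) If $s<S$, set, for $m=1,\dots,S-s$, $$L_{s+m,s}=(c_{sm,1}\boldsymbol{1}_{d_{s+m}},\dots,c_{sm,d_s}\boldsymbol{1}_{d_{s+m}})\in\mathbb{R}^{d_{s+m}\times d_s},$$ where $(c_{sm,1},\dots,c_{sm,d_s})$ can be sequentially determined via $$c_{sm,j}\tilde l_{ss,j}+\sum_{k=1}^{j-1}c_{sm,k}l_{ss,k}=\rho^{(s)}_{m+1,1},\quad j=1,\dots,d_s.$$ 2.3) If $s<S$, set $\overline P(s+1)$ to be of the form displayed in step 2) (with $s+1$ in place of $s$) with $$\rho_t^{(s+1)}=\rho_{t+1}^{(s)}+\frac{d_s(\rho_{t+1,1}^{(s)})^2}{\rho_1^{(s)}+(d_s-1)\rho_{1,o}^{(s)}},\qquad \rho_{t,o}^{(s+1)}=\rho_{t+1,o}^{(s)}+\frac{d_s(\rho_{t+1,1}^{(s)})^2}{\rho_1^{(s)}+(d_s-1)\rho_{1,o}^{(s)}}$$ for $t\in\{1,\dots,S-s\}$, and $$\rho_{s_1,s_2}^{(s+1)}=\rho_{s_1+1,s_2+1}^{(s)}+\frac{d_s\,\rho_{s_1+1,1}^{(s)}\rho_{s_2+1,1}^{(s)}}{\rho_1^{(s)}+(d_s-1)\rho_{1,o}^{(s)}}$$ for $s_1,s_2\in\{1,\dots,S-s\}$. 3)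 Return the Cholesky factor $L$ of $P$, where $$L=\begin{pmatrix}L_{11}&O&\cdots&O\\ L_{21}&L_{22}&\ddots&O\\ \vdots&\vdots&\ddots&\vdots\\ L_{S1}&L_{S2}&\cdots&L_{SS}\end{pmatrix}$$ and $O$ represents a block of zeros.
   Context: A block homogeneous matrix is a symmetric matrix in $[-1,1]^{d\times d}$ with unit diagonal of the form $P=(P_{s_1s_2})_{s_1,s_2=1}^S$ with blocks $P_{ss}=(1-\rho_{ss})I_{d_s}+\rho_{ss}J_{d_s}$ and, for $s_1\neq s_2$, $P_{s_1s_2}=\rho_{s_1s_2}J_{d_{s_1}d_{s_2}}$, where $I_n$ is the $n\times n$ identity matrix, $J_{nm}$ the $n\times m$ matrix of ones, $J_n=J_{nn}$, and $\rho_{s_1s_2}=\rho_{s_2s_1}$. It is a block homogeneous correlation matrix if it is in addition a correlation matrix, that is, positive semi-definite. $\Gamma_n(a,b)=(a-b)I_n+bJ_n$ is the $n$-dimensional compound symmetry matrix with diagonal entries $a$ and off-diagonal entries $b$. The Cholesky decomposition of a positive definite (positive semi-definite) matrix $P$ is $P=LL^\top$ for a lower triangular matrix $L$ with positive (non-negative) diagonal elements; $L$ is called the Cholesky factor of $P$. $\boldsymbol{1}_n\in\mathbb{R}^n$ denotes the column vector of ones.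
   Formalization: In step 2.3 the three plus signs are replaced by minus signs (with plus, L Lᵀ ≠ P already for d_1 = d_2 = 1, ρ_12 = 1/2); for singular P, quotients with zero denominator are taken as 0, and c_{sm,j} is taken as 0 when l̃_{ss,j} = 0. *)

(* Defs.v *)
From HB Require Import structures.
From mathcomp Require Import all_boot all_order all_algebra.

Set Implicit Arguments.
Unset Strict Implicit.
Unset Printing Implicit Defensive.

Import Order.TTheory GRing.Theory Num.Theory.
Local Open Scope ring_scope.

(* All indices start at 0: groups are s = 0, ..., S - 1, of sizes d s (the
   values of d at or beyond S are irrelevant), and a matrix with these groups
   has size \sum_(s < S) d s, with blocks given by submxblock. *)

Definition possemidef (R : rcfType) (n : nat) (M : 'M[R]_n) : Prop :=
  M^T = M /\ forall x : 'cV[R]_n, 0 <= (x^T *m M *m x) 0 0.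

Definition posdef (R : rcfType) (n : nat) (M : 'M[R]_n) : Prop :=
  M^T = M /\ forall x : 'cV[R]_n, x != 0 -> 0 < (x^T *m M *m x) 0 0.

(* (a - b) I_n + b J_n *)
Definition Gamma (R : rcfType) (n : nat) (a b : R) : 'M[R]_n :=
  (a - b)%:M + const_mx b.

(* The s-th diagonal block is Gamma_{d s}(a s, b s) and the off-diagonal block
   (s1, s2) is r s1 s2 J. The matrix does not determine b s when d s = 1, nor
   the values r s s, which are never used. *)
Definition has_block_form (R : rcfType) (S : nat) (d : nat -> nat)
    (a b : nat -> R) (r : nat -> nat -> R)
    (M : 'M[R]_(\sum_(s < S) d s)) : Prop :=
  (forall s : 'I_S, submxblock M s s = Gamma (d s) (a s) (b s)) /\
  (forall s1 s2 : 'I_S, s1 != s2 -> submxblock M s1 s2 = const_mx (r s1 s2)).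

Definition block_homogeneous (R : rcfType) (S : nat) (d : nat -> nat)
    (P : 'M[R]_(\sum_(s < S) d s)) : Prop :=
  [/\ P^T = P,
      forall i j, -1 <= P i j <= 1,
      forall i, P i i = 1 &
      exists2 rho : nat -> nat -> R,
        forall s1 s2, rho s1 s2 = rho s2 s1 &
        has_block_form (fun=> 1) (fun s => rho s s) rho P].

Definition block_homogeneous_correlation (R : rcfType) (S : nat)
    (d : nat -> nat) (P : 'M[R]_(\sum_(s < S) d s)) : Prop :=
  block_homogeneous P /\ possemidef P.

Definition is_Cholesky_factor (R : rcfType) (n : nat) (P L : 'M[R]_n) : Prop :=
  [/\ is_trig_mx L,
      forall i, 0 <= L i i,
      posdef P -> forall i, 0 < L i i &
      P = L *m L^T].

(* One execution of the algorithm on P, with output L.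
   The matrix \bar P(s) is represented by its parameters: its t-th diagonal
   block, of size d (s + t), is Gamma (dg s t) (od s t), and its off-diagonal
   block (t1, t2) is the constant cr s t1 t2, where t, t1, t2 < S - s count
   from the current pivot group s. Similarly, c s m, for 0 < m < S - s,
   belongs to the block of L in block row s + m and block column s.
   If P is singular, some ltil s j may vanish. Then division by zero gives
   l s j = 0, and the j-th equation for c s m does not determine c s m j, which
   is taken to be 0 (other solutions need not give a factor of P).
   The Schur complement P_22 - P_21 P_11^-1 P_12 of the pivot block accounts
   for the minus signs in the updates of dg, od and cr. *)
Record Cholesky_run (R : rcfType) (S : nat) (d : nat -> nat)
    (P : 'M[R]_(\sum_(s < S) d s))
    (dg od : nat -> nat -> R) (cr : nat -> nat -> nat -> R)
    (ltil l : nat -> nat -> R) (c : nat -> nat -> nat -> R)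
    (L : 'M[R]_(\sum_(s < S) d s)) : Prop := {
  run_init : has_block_form (dg 0%N) (od 0%N) (cr 0%N) P;

  run_ltil : forall s j, (s < S)%N -> (j < d s)%N ->
    ltil s j = Num.sqrt (dg s 0%N - \sum_(k < j) l s k ^+ 2);
  run_l : forall s j, (s < S)%N -> (j < d s)%N ->
    l s j = 1 / ltil s j * (od s 0%N - \sum_(k < j) l s k ^+ 2);

  run_c : forall s m j, (0 < m)%N -> (s + m < S)%N -> (j < d s)%N ->
    c s m j * ltil s j + \sum_(k < j) c s m k * l s k = cr s m 0%N;
  run_c0 : forall s m j, (0 < m)%N -> (s + m < S)%N -> (j < d s)%N ->
    ltil s j = 0 -> c s m j = 0;

  run_dg : forall s t, (s.+1 + t < S)%N ->
    dg s.+1 t = dg s t.+1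
      - (d s)%:R * cr s t.+1 0%N ^+ 2
        / (dg s 0%N + ((d s)%:R - 1) * od s 0%N);
  run_od : forall s t, (s.+1 + t < S)%N ->
    od s.+1 t = od s t.+1
      - (d s)%:R * cr s t.+1 0%N ^+ 2
        / (dg s 0%N + ((d s)%:R - 1) * od s 0%N);
  run_cr : forall s t1 t2, (s.+1 + t1 < S)%N -> (s.+1 + t2 < S)%N ->
    cr s.+1 t1 t2 = cr s t1.+1 t2.+1
      - (d s)%:R * cr s t1.+1 0%N * cr s t2.+1 0%N
        / (dg s 0%N + ((d s)%:R - 1) * od s 0%N);

  run_L_diag : forall s : 'I_S,
    submxblock L s s =
      \matrix_(i < d s, j < d s)
        (if (i < j)%N then 0 else if i == j then ltil s j else l s j);
  run_L_lower : forall s1 s2 : 'I_S, (s2 < s1)%N ->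
    submxblock L s1 s2 =
      \matrix_(i < d s1, j < d s2) c s2 (s1 - s2)%N j;
  run_L_upper : forall s1 s2 : 'I_S, (s1 < s2)%N -> submxblock L s1 s2 = 0
}.

Definition algorithm_returns (R : rcfType) (S : nat) (d : nat -> nat)
    (P L : 'M[R]_(\sum_(s < S) d s)) : Prop :=
  exists dg od cr ltil l c, Cholesky_run P dg od cr ltil l c L.

(* Main.v *)
Require Import Defs.
From HB Require Import structures.
From mathcomp Require Import all_boot all_order all_algebra.
From mathcomp Require Import ring lra.

Set Implicit Arguments.
Unset Strict Implicit.
Unset Printing Implicit Defensive.

Import Order.TTheory GRing.Theory Num.Theory.
Local Open Scope ring_scope.

(** Why the algorithm returns a Cholesky factor.

    The algorithm is block outer-product elimination: stage [s] removes from
    the current matrix the contribution [C C^T] of the block column [C] of [L]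
    that it computes, and [P = L L^T] follows by adding these contributions up
    ([unroll_schur], [Cholesky_run_factor]).  Two facts make this work.

    - Within the pivot block [Gamma_n(a,b)], scalar elimination of the first
      row leaves the compound symmetry matrix
      [Gamma_{n-1}(a - b^2/a, b - b^2/a)], so induction on [n] shows that the
      sequences [ltil], [l] factor the block ([pivot_factor]).  The same
      induction shows that the triangular equations for the rows [c] are
      solvable ([row_seq_solves]) and that two rows with right-hand sides [r]
      and [r'] have inner product [n r r' / (a + (n-1) b)] ([row_seq_dot]).
      This last number is [r r' 1^T Gamma_n(a,b)^{-1} 1] for an invertible
      block, and it is the quantity subtracted by the parameter updates.

    - All stages remain positive semi-definite.  A matrix of block form is
      controlled by the numbers [a_t - b_t], which the updates do not change,
      and by the [S x S] matrix of its block means, on which the updates act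
      as one step of scalar elimination; and the Schur complement of a positive
      semi-definite matrix is positive semi-definite ([psd_form_schur],
      [stage_psd_step]).

    Singular matrices are covered by the convention [x / 0 = 0].  If the pivot
    block annihilates the vector of ones, i.e. [a + (n-1) b = 0], then
    semi-definiteness forces the off-diagonal blocks of its column to vanish
    ([stage_zero_pivot]), so all the identities above remain true.  If [P] is
    positive definite, then [L] is invertible, and its diagonal, which consists
    of square roots, is positive. *)

(** * Positive semi-definite forms and scalar Schur complements *)

Section ScalarForms.
Variable R : rcfType.
Implicit Types (M : nat -> nat -> R) (x y : nat -> R).

(** The quadratic form of the leading [n x n] part of an infinite matrix;
    indexing by [nat] makes passing to a Schur complement a mere shift. *)
Definition quad_form (n : nat) M x : R :=
  \sum_(i < n) \sum_(j < n) x i * M i j * x j.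

(** Symmetry and positive semi-definiteness of the leading [n x n] part. *)
Definition psd_form (n : nat) M : Prop :=
  (forall i j, (i < n)%N -> (j < n)%N -> M i j = M j i) /\
  (forall x, 0 <= quad_form n M x).

Lemma quad_formS n M (x0 : R) y :
  (forall i, (i < n)%N -> M 0%N i.+1 = M i.+1 0%N) ->
  quad_form n.+1 M (fun i => if i is j.+1 then y j else x0) =
  M 0%N 0%N * x0 ^+ 2 + 2 * x0 * (\sum_(i < n) M i.+1 0%N * y i)
    + quad_form n (fun i j => M i.+1 j.+1) y.
Proof.
move=> sym; rewrite /quad_form big_ord_recl big_ord_recl /=.
under [X in _ + X]eq_bigr do rewrite big_ord_recl /=.
rewrite big_split /=.
have -> : \sum_(i < n) x0 * M 0%N i.+1 * y i =
    x0 * \sum_(i < n) M i.+1 0%N * y i.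
  by rewrite mulr_sumr; apply: eq_bigr => i _; rewrite sym ?ltn_ord // mulrA.
have -> : \sum_(i < n) y i * M i.+1 0%N * x0 =
    x0 * \sum_(i < n) M i.+1 0%N * y i.
  by rewrite mulr_sumr; apply: eq_bigr => i _; ring.
ring.
Qed.

Lemma psd_formS n M : psd_form n.+1 M ->
  forall (x0 : R) y, 0 <= M 0%N 0%N * x0 ^+ 2
    + 2 * x0 * (\sum_(i < n) M i.+1 0%N * y i)
    + quad_form n (fun i j => M i.+1 j.+1) y.
Proof. by move=> [sym pos] x0 y; rewrite -quad_formS // => i ltin; apply: sym. Qed.

Lemma eq_psd_form n M M' :
  (forall i j, (i < n)%N -> (j < n)%N -> M i j = M' i j) ->
  psd_form n M' -> psd_form n M.
Proof.
move=> eqM [sym pos]; split=> [i j ltin ltjn|x]; first by rewrite !eqM // sym.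
rewrite /quad_form.
under eq_bigr => i _ do under eq_bigr => j _ do rewrite eqM //.
exact: pos.
Qed.

Lemma psd_form_pivot_ge0 n M : psd_form n.+1 M -> 0 <= M 0%N 0%N.
Proof.
move=> /psd_formS /(_ 1 (fun=> 0)).
have -> : quad_form n (fun i j => M i.+1 j.+1) (fun=> 0) = 0.
  by apply: big1 => i _; apply: big1 => j _; rewrite mulr0.
rewrite big1 => [|i _]; last by rewrite mulr0.
by rewrite expr1n mulr1 mulr0 !addr0.
Qed.

Lemma psd_form_zero_pivot n M i : psd_form n.+1 M -> M 0%N 0%N = 0 ->
  (i < n)%N -> M i.+1 0%N = 0.
Proof.
move=> psdM M00 ltin; apply/eqP/negPn/negP => nz.
pose y k : R := (k == i)%:R.
have := psd_formS psdM _ y; set C := quad_form _ _ _ => ge0.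
(* For this value of the first coordinate the form equals -1. *)
have := ge0 (- (C + 1) / (2 * M i.+1 0%N)).
have -> : \sum_(k < n) M k.+1 0%N * y k = M i.+1 0%N.
  rewrite (bigD1 (Ordinal ltin)) //= /y eqxx mulr1 big1 ?addr0 // => k.
  by rewrite -val_eqE /= => /negPf->; rewrite mulr0.
rewrite M00 mul0r add0r.
have -> : 2 * (- (C + 1) / (2 * M i.+1 0%N)) * M i.+1 0%N + C = -1 by field.
by rewrite ler0N1.
Qed.

(** When the pivot is zero, division by zero makes this the plain trailing
    submatrix. *)
Lemma psd_form_schur n M : psd_form n.+1 M ->
  psd_form n (fun i j => M i.+1 j.+1 - M i.+1 0%N * M j.+1 0%N / M 0%N 0%N).
Proof.
move=> psdM; have [sym _] := psdM; split=> [i j ltin ltjn|y].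
  by rewrite sym // [_ * M j.+1 _]mulrC.
pose B := \sum_(i < n) M i.+1 0%N * y i.
have -> : quad_form n
    (fun i j => M i.+1 j.+1 - M i.+1 0%N * M j.+1 0%N / M 0%N 0%N) y =
    quad_form n (fun i j => M i.+1 j.+1) y - B ^+ 2 / M 0%N 0%N.
  rewrite expr2 /B mulr_suml mulr_suml -sumrB; apply: eq_bigr => i _.
  rewrite mulr_sumr mulr_suml -sumrB; apply: eq_bigr => j _; ring.
(* For a nonzero pivot, the form at y is the minimum over x0 of the full form
   at (x0, y), attained at x0 = - B / M 0 0. *)
have := psd_formS psdM (- B / M 0%N 0%N) y; rewrite -/B.
have [->|nz] := eqVneq (M 0%N 0%N) 0.
  by rewrite invr0 !mulr0 !mul0r !add0r subr0.
suff -> : M 0%N 0%N * (- B / M 0%N 0%N) ^+ 2 + 2 * (- B / M 0%N 0%N) * B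
  = - (B ^+ 2 / M 0%N 0%N) by rewrite addrC.
by field.
Qed.

End ScalarForms.

(** * Factorization of a compound symmetry block *)

Section Pivot.
Variable R : rcfType.
Implicit Types (a b r : R) (ltil l c : nat -> R).

(** [ltil] and [l] are the sequences that define the lower triangular factor of
    [Gamma n a b]: [ltil j] on the diagonal and [l j] below it, in column [j]. *)
Definition pivot_seq (n : nat) a b ltil l : Prop :=
  forall j, (j < n)%N ->
    ltil j = Num.sqrt (a - \sum_(k < j) l k ^+ 2) /\
    l j = 1 / ltil j * (b - \sum_(k < j) l k ^+ 2).

(** [c] is a constant row of the block of [L] below the pivot block, for the
    right-hand side [r]; [c j = 0] where [ltil j = 0]. *)
Definition row_seq (n : nat) ltil l r c : Prop :=
  forall j, (j < n)%N -> c j = (r - \sum_(k < j) c k * l k) / ltil j.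

(** The eigenvalue of [Gamma n a b] on the vector of ones. *)
Definition ones_eig (n : nat) a b : R := a + (n%:R - 1) * b.

(** Positive semi-definiteness of [Gamma n a b] for [n > 0]; the eigenvalue
    [a - b] is present only for [n > 1]. *)
Definition pivot_psd (n : nat) a b : Prop :=
  ((1 < n)%N -> b <= a) /\ 0 <= ones_eig n a b.

Lemma pivot_seqS n a b ltil l : pivot_seq n.+1 a b ltil l ->
  pivot_seq n (a - l 0%N ^+ 2) (b - l 0%N ^+ 2)
    (fun j => ltil j.+1) (fun j => l j.+1).
Proof.
move=> piv j ltjn; have [-> ->] := piv j.+1 ltjn.
by rewrite !big_ord_recl /= !opprD !addrA.
Qed.

Lemma row_seqS n ltil l r c : row_seq n.+1 ltil l r c ->
  row_seq n (fun j => ltil j.+1) (fun j => l j.+1) (r - c 0%N * l 0%N)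
    (fun j => c j.+1).
Proof.
by move=> row j ltjn; rewrite row // big_ord_recl /= opprD addrA.
Qed.

Lemma pivot_head n a b ltil l : (0 < n)%N -> pivot_psd n a b ->
  pivot_seq n a b ltil l ->
  [/\ 0 <= a, ltil 0%N = Num.sqrt a & l 0%N = b / Num.sqrt a].
Proof.
move=> n_gt0 [leba detge0] /(_ 0%N n_gt0); rewrite !big_ord0 !subr0 => -[-> ->].
split=> //; last by rewrite mul1r mulrC.
case: n n_gt0 leba detge0 => [|[|n]] // _.
  by rewrite /ones_eig subrr mul0r addr0.
move=> /(_ isT) leba; apply: contra_leT => a_lt0.
have : 0 <= n%:R :> R by rewrite ler0n.
rewrite /ones_eig -natr1 addrK -natr1; nra.
Qed.

(** Eliminating the first row of [Gamma n.+2 a b] leaves the semi-definite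
    block [Gamma n.+1 (a - b^2/a) (b - b^2/a)]. *)
Lemma pivot_schur n a b ltil l : pivot_psd n.+2 a b ->
  pivot_seq n.+2 a b ltil l ->
  pivot_psd n.+1 (a - l 0%N ^+ 2) (b - l 0%N ^+ 2) /\
  ones_eig n.+1 (a - l 0%N ^+ 2) (b - l 0%N ^+ 2) * a =
    (a - b) * ones_eig n.+2 a b.
Proof.
move=> psd piv; have [a_ge0 _ l0] := pivot_head (ltn0Sn _) psd piv.
have [/(_ isT) leba detge0] := psd.
have n_ge0 : 0 <= n%:R :> R by rewrite ler0n.
(* For a = 0, semi-definiteness forces b = 0. *)
have aE : l 0%N ^+ 2 * a = b ^+ 2.
  rewrite l0 expr_div_n sqr_sqrtr //; have [a0|nz] := eqVneq a 0; last by field.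
  move: detge0; rewrite /ones_eig a0 -natr1 addrK -natr1 => detge0.
  have -> : b = 0 by nra.
  by rewrite expr0n mulr0.
have detE : ones_eig n.+1 (a - l 0%N ^+ 2) (b - l 0%N ^+ 2) * a =
    (a - b) * ones_eig n.+2 a b.
  rewrite /ones_eig -[n.+2%:R]natr1 -natr1 !addrK.
  transitivity (a * a + n%:R * b * a - (n%:R + 1) * (l 0%N ^+ 2 * a)).
    by ring.
  by rewrite aE; ring.
split=> //; split=> [_|]; first by rewrite lerD2r.
have [a0|nz] := eqVneq a 0.
  have b0 : b = 0.
    by move: detge0; rewrite /ones_eig a0 -natr1 addrK -natr1; nra.
  by rewrite l0 a0 b0 mul0r expr0n /ones_eig !subr0 mulr0 addr0.
have a_gt0 : 0 < a by rewrite lt_def nz.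
by rewrite -(pmulr_lge0 _ a_gt0) detE mulr_ge0 // subr_ge0.
Qed.

Lemma pivot_factor n a b ltil l : pivot_psd n a b -> pivot_seq n a b ltil l ->
  (forall j, (j < n)%N -> ltil j ^+ 2 = a - \sum_(k < j) l k ^+ 2) /\
  (forall j, (j.+1 < n)%N -> l j * ltil j = b - \sum_(k < j) l k ^+ 2).
Proof.
elim: n a b ltil l => [|n IHn] a b ltil l psd piv //.
have [a_ge0 ltil0 l0] := pivot_head (ltn0Sn _) psd piv.
split=> -[n_gt0|j ltjn]; rewrite ?big_ord0 ?subr0.
- by rewrite ltil0 sqr_sqrtr.
- case: n ltjn IHn psd piv => // n ltjn IHn psd piv.
  have [psd' _] := pivot_schur psd piv.
  have [/(_ j ltjn)-> _] := IHn _ _ _ _ psd' (pivot_seqS piv).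
  by rewrite big_ord_recl opprD addrA.
- rewrite ltil0 l0; have [s0|nz] := eqVneq (Num.sqrt a) 0; last first.
    by rewrite divfK.
  rewrite s0 mulr0; move: psd => [/(_ n_gt0) leba].
  have a0 : a = 0 by apply/eqP; rewrite eq_le a_ge0 -sqrtr_eq0 s0 eqxx.
  case: n {IHn piv} n_gt0 => // n _.
  have n_ge0 : 0 <= n%:R :> R by rewrite ler0n.
  by rewrite /ones_eig a0 -natr1 addrK -natr1; nra.
case: n ltjn IHn psd piv => // n ltjn IHn psd piv.
have [psd' _] := pivot_schur psd piv.
have [_ /(_ j ltjn)->] := IHn _ _ _ _ psd' (pivot_seqS piv).
by rewrite big_ord_recl opprD addrA.
Qed.

(** The condition on [ones_eig] says that the constant vector [r] is in the
    range of the block when the block annihilates the vector of ones. *)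
Lemma row_residual n a b ltil l r c :
  pivot_psd n.+1 a b -> pivot_seq n.+1 a b ltil l -> row_seq n.+1 ltil l r c ->
  (ones_eig n.+1 a b = 0 -> r = 0) ->
  c 0%N = r / Num.sqrt a /\ (a = 0 -> r = 0).
Proof.
move=> psd piv row r_det.
have [a_ge0 ltil0 l0] := pivot_head (ltn0Sn _) psd piv.
split=> [|a0]; first by rewrite row // big_ord0 subr0 ltil0.
apply: r_det; move: psd => [].
case: n {piv row} => [|n]; rewrite /ones_eig a0 ?subrr ?mul0r ?addr0 //.
have n_ge0 : 0 <= n%:R :> R by rewrite ler0n.
move=> /(_ isT) leb0; rewrite -natr1 addrK -natr1 => ge0.
have -> : b = 0 by nra.
by rewrite mulr0 addr0.
Qed.

(** The residual right-hand side after one elimination step is [r (a - b) / a],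
    and it inherits the compatibility condition of singular blocks. *)
Lemma row_residual_schur n a b ltil l r c :
  pivot_psd n.+2 a b -> pivot_seq n.+2 a b ltil l -> row_seq n.+2 ltil l r c ->
  (ones_eig n.+2 a b = 0 -> r = 0) ->
  (r - c 0%N * l 0%N) * a = r * (a - b) /\
  (ones_eig n.+1 (a - l 0%N ^+ 2) (b - l 0%N ^+ 2) = 0 ->
   r - c 0%N * l 0%N = 0).
Proof.
move=> psd piv row r_det; have [a_ge0 _ l0] := pivot_head (ltn0Sn _) psd piv.
have [c0 a0r] := row_residual psd piv row r_det.
have [_ det'] := pivot_schur psd piv.
have [a0|nz] := eqVneq a 0.
  by rewrite c0 (a0r a0) a0 !(mul0r, mulr0) subr0.
have resE : (r - c 0%N * l 0%N) * a = r * (a - b).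
  have -> : c 0%N * l 0%N = r * b / a.
    by rewrite c0 l0 mulf_div -expr2 sqr_sqrtr.
  by field.
split=> // det0; apply: (mulIf nz); rewrite resE mul0r.
move: det'; rewrite det0 mul0r => /esym /eqP; rewrite mulf_eq0.
case/orP=> [/eqP->|/eqP D0]; first by rewrite mulr0.
by rewrite r_det // mul0r.
Qed.

Lemma row_seq_solves n a b ltil l r c :
  pivot_psd n a b -> pivot_seq n a b ltil l -> row_seq n ltil l r c ->
  (ones_eig n a b = 0 -> r = 0) ->
  forall j, (j < n)%N -> c j * ltil j + \sum_(k < j) c k * l k = r.
Proof.
elim: n a b ltil l r c => // n IHn a b ltil l r c psd piv row r_det.
have [c0 a0r] := row_residual psd piv row r_det.
have [a_ge0 ltil0 _] := pivot_head (ltn0Sn _) psd piv.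
case=> [_|j ltjn].
  rewrite big_ord0 addr0 ltil0 c0; have [s0|nz] := eqVneq (Num.sqrt a) 0.
    by rewrite s0 mulr0 a0r //; apply/eqP; rewrite eq_le a_ge0 -sqrtr_eq0 s0 eqxx.
  by rewrite divfK.
case: n ltjn IHn psd piv row r_det => // n ltjn IHn psd piv row r_det.
have [psd' _] := pivot_schur psd piv.
have [_ res0] := row_residual_schur psd piv row r_det.
rewrite big_ord_recl addrCA.
rewrite (IHn _ _ _ _ _ _ psd' (pivot_seqS piv) (row_seqS row) res0) //.
by rewrite addrC subrK.
Qed.

(** The inner product of two rows is [r r' 1^T G^+ 1], where [G^+] is the
    pseudo-inverse of the pivot block [G = Gamma n a b]. *)
Lemma row_seq_dot n a b ltil l r r' c c' :
  pivot_psd n a b -> pivot_seq n a b ltil l ->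
  row_seq n ltil l r c -> row_seq n ltil l r' c' ->
  (ones_eig n a b = 0 -> r = 0) -> (ones_eig n a b = 0 -> r' = 0) ->
  \sum_(k < n) c k * c' k = n%:R * r * r' / ones_eig n a b.
Proof.
elim: n a b ltil l r r' c c' =>
    [|n IHn] a b ltil l r r' c c' psd piv row row' r_det r'_det.
  by rewrite big_ord0 !mul0r.
have [c0 a0r] := row_residual psd piv row r_det.
have [c'0 _] := row_residual psd piv row' r'_det.
have [a_ge0 _ _] := pivot_head (ltn0Sn _) psd piv.
have headE : c 0%N * c' 0%N = r * r' / a.
  by rewrite c0 c'0 mulf_div -expr2 sqr_sqrtr.
rewrite big_ord_recl /= headE.
case: n IHn psd piv row row' r_det r'_det =>
    [|n] IHn psd piv row row' r_det r'_det.
  by rewrite big_ord0 addr0 /ones_eig subrr mul0r addr0 mul1r.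
have [psd' det'] := pivot_schur psd piv.
have [resE res0] := row_residual_schur psd piv row r_det.
have [resE' res0'] := row_residual_schur psd piv row' r'_det.
rewrite (IHn _ _ _ _ _ _ _ _ psd' (pivot_seqS piv) (row_seqS row)
           (row_seqS row') res0 res0').
have [a0|nz] := eqVneq a 0.
  by rewrite c0 (a0r a0) !(mul0r, mulr0) !subr0 !(mul0r, mulr0) addr0.
have [D0|Dnz] := eqVneq (ones_eig n.+2 a b) 0.
  by rewrite c0 (r_det D0) !(mul0r, mulr0) subr0 !(mul0r, mulr0) addr0.
have -> : r - c 0%N * l 0%N = r * (a - b) / a.
  by apply: (mulIf nz); rewrite divfK.
have -> : r' - c' 0%N * l 0%N = r' * (a - b) / a.
  by apply: (mulIf nz); rewrite divfK.
have -> : ones_eig n.+1 (a - l 0%N ^+ 2) (b - l 0%N ^+ 2)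
   = (a - b) * ones_eig n.+2 a b / a by apply: (mulIf nz); rewrite divfK.
move: Dnz; rewrite /ones_eig -[n.+2%:R]natr1 addrK -natr1 => Dnz.
(* If a = b the block has rank one, and nothing remains after one step. *)
have [ab|abnz] := eqVneq (a - b) 0; last by field; rewrite abnz nz Dnz.
rewrite ab !(mul0r, mulr0, invr0) addr0.
move: Dnz; have -> : b = a by move/eqP: ab; rewrite subr_eq0 => /eqP.
by move=> Dnz; field; rewrite nz Dnz.
Qed.

End Pivot.

(** * Semi-definiteness of every stage *)

Lemma possemidef_pair (R : rcfType) n (M : 'M[R]_n) p q : possemidef M ->
  0 <= M p p + M q q - M p q - M q p.
Proof.
move=> [_ /(_ (delta_mx p 0 - delta_mx q 0))].
have -> : (delta_mx p 0 - delta_mx q 0)^T = delta_mx 0 p - delta_mx 0 q :> 'rV[R]_n.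
  by rewrite raddfB /= !trmx_delta.
rewrite mulmxBl !mulmxBr -!rowE -!colE !mxE.
by congr (0 <= _); ring.
Qed.

Lemma sum_Gamma (R : rcfType) n (a b : R) :
  \sum_i \sum_j Gamma n a b j i = n%:R * ones_eig n a b.
Proof.
transitivity (\sum_(i < n) ((a - b) + n%:R * b)); last first.
  by rewrite sumr_const card_ord -mulr_natl /ones_eig; ring.
apply: eq_bigr => i _; under eq_bigr do rewrite !mxE.
rewrite big_split /= sumr_const card_ord mulr_natl; congr (_ + _).
rewrite (bigD1 i) //= eqxx mulr1n big1 ?addr0 // => j /negPf->.
by rewrite mulr0n.
Qed.

Section Reduction.
Variables (R : rcfType) (S : nat) (d : nat -> nat).
Hypothesis d_gt0 : forall s, (s < S)%N -> (0 < d s)%N.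
Variables (dg od : nat -> nat -> R) (cr : nat -> nat -> nat -> R).

(** The mean of the entries of block [(t1, t2)] at stage [s]. *)
Definition group_mean (s t1 t2 : nat) : R :=
  if t1 == t2 then ones_eig (d (s + t1)) (dg s t1) (od s t1) / (d (s + t1))%:R
  else cr s t1 t2.

(** Positive semi-definiteness of the matrix at stage [s], as a property of its
    parameters: the matrix of block means is semi-definite, and each diagonal
    block of size at least 2 is semi-definite on vectors of zero sum. *)
Definition stage_psd (s : nat) : Prop :=
  psd_form (S - s) (group_mean s) /\
  (forall t, (s + t < S)%N -> (1 < d (s + t))%N -> od s t <= dg s t).

(** The parameter updates from stage [s] to stage [s + 1]. *)
Definition stage_update (s : nat) : Prop :=
  forall t1 t2, (s.+1 + t1 < S)%N -> (s.+1 + t2 < S)%N ->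
  [/\ dg s.+1 t1 = dg s t1.+1
        - (d s)%:R * cr s t1.+1 0%N ^+ 2 / ones_eig (d s) (dg s 0%N) (od s 0%N),
      od s.+1 t1 = od s t1.+1
        - (d s)%:R * cr s t1.+1 0%N ^+ 2 / ones_eig (d s) (dg s 0%N) (od s 0%N) &
      cr s.+1 t1 t2 = cr s t1.+1 t2.+1
        - (d s)%:R * cr s t1.+1 0%N * cr s t2.+1 0%N
          / ones_eig (d s) (dg s 0%N) (od s 0%N)].

Lemma natr_group_neq0 s : (s < S)%N -> (d s)%:R != 0 :> R.
Proof. by move=> /d_gt0; rewrite pnatr_eq0 -lt0n. Qed.

(** The updates preserve [dg - od] and take the matrix of block means to its
    Schur complement. *)
Lemma stage_psd_step s : (s < S)%N -> stage_update s ->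
  stage_psd s -> stage_psd s.+1.
Proof.
move=> ltsS upd [psd le]; split=> [|t lttS d_gt1]; last first.
  have [-> -> _] := upd t t lttS lttS.
  by rewrite lerD2r le // addnS -addSn.
have SE : (S - s)%N = (S - s.+1).+1 by rewrite subnSK.
move: psd; rewrite SE => psd; apply: eq_psd_form (psd_form_schur psd) => i j.
rewrite !ltn_subRL => ltiS ltjS; rewrite /group_mean /= addn0 eqSS.
have [dgE odE crE] := upd i j ltiS ltjS.
have pnz := natr_group_neq0 ltsS; have inz := natr_group_neq0 ltiS.
rewrite invfM invrK.
have [<-|_] := eqVneq i j; last by rewrite crE; congr (_ - _); ring.
rewrite addnS -addSn dgE odE /ones_eig.
by set D := (_ + (_ - 1) * od s 0%N)^-1; field.
Qed.

Lemma stage_psd_all s : (forall u, (u < s)%N -> stage_update u) ->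
  (s < S)%N -> stage_psd 0 -> stage_psd s.
Proof.
elim: s => // s IHs upd ltsS psd0; have lts := ltnW ltsS.
apply: stage_psd_step => //; first exact: upd.
by apply: IHs => // u ltus; apply: upd; apply: ltnW.
Qed.

Lemma stage_pivot_psd s : (s < S)%N -> stage_psd s ->
  pivot_psd (d s) (dg s 0%N) (od s 0%N).
Proof.
move=> ltsS [psd le]; split=> [d_gt1|]; first by apply: le; rewrite addn0.
move: psd; rewrite -subnSK // => /psd_form_pivot_ge0.
rewrite /group_mean eqxx addn0 pmulr_lge0 // invr_gt0 ltr0n; exact: d_gt0.
Qed.

Lemma stage_zero_pivot s m : (0 < m)%N -> (s + m < S)%N -> stage_psd s ->
  ones_eig (d s) (dg s 0%N) (od s 0%N) = 0 -> cr s m 0%N = 0.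
Proof.
case: m => // m _ ltmS [psd _] det0.
have ltsS : (s < S)%N by apply: leq_ltn_trans ltmS; apply: leq_addr.
move: psd; rewrite -subnSK // => /psd_form_zero_pivot; apply.
  by rewrite /group_mean eqxx addn0 det0 mul0r.
by rewrite ltn_subRL addSn -addnS.
Qed.

Lemma stage_psd_init (P : 'M[R]_(\sum_(s < S) d s)) :
  has_block_form (dg 0%N) (od 0%N) (cr 0%N) P -> possemidef P -> stage_psd 0.
Proof.
move=> [Pdiag Poff] [Psym Ppos]; split=> [|t ltts d_gt1]; last first.
  rewrite add0n in ltts d_gt1; pose s := Ordinal ltts.
  pose i : 'I_(d s) := Ordinal (d_gt0 ltts).
  pose j : 'I_(d s) := Ordinal d_gt1.
  (* Rank s i is the global index of the i-th index of group s. *)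
  pose p := tagnat.Rank (p_ := fun s : 'I_S => d s) s i.
  pose q := tagnat.Rank (p_ := fun s : 'I_S => d s) s j.
  have entry k k' : P (tagnat.Rank s k) (tagnat.Rank s k') =
      Gamma (d s) (dg 0%N s) (od 0%N s) k k'.
    by rewrite -Pdiag !mxE.
  have := possemidef_pair p q (conj Psym Ppos).
  rewrite !entry !mxE eqxx /= ?mulr0n ?mulr1n; lra.
rewrite subn0; split=> [i j ltiS ltjS|x].
  rewrite /group_mean; have [->//|neq] := eqVneq i j.
  have nq : Ordinal ltiS != Ordinal ltjS by [].
  have := Poff _ _ nq; rewrite -Psym -tr_submxblock Poff 1?eq_sym //.
  move=> /matrixP /(_ (Ordinal (d_gt0 ltiS)) (Ordinal (d_gt0 ltjS))).
  by rewrite !mxE.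
(* The form of the block means at x is the form of P at the vector equal to
   x s / d s on group s. *)
pose X := \mxcol_(s < S) (const_mx (x s / (d s)%:R) : 'cV[R]_(d s)).
suff <- : (X^T *m P *m X) 0 0 = quad_form S (group_mean 0) x by [].
rewrite tr_mxcol -{1}[P]submxblockK mul_mxrow_mxblock mul_mxrow_mxcol summxE.
rewrite /quad_form exchange_big /=; apply: eq_bigr => t _.
rewrite mulmx_suml summxE; apply: eq_bigr => s _.
have dsn0 := natr_group_neq0 (ltn_ord s).
have dtn0 := natr_group_neq0 (ltn_ord t).
have sumE : \sum_i \sum_j submxblock P s t j i
    = (d s)%:R * group_mean 0 s t * (d t)%:R.
  rewrite /group_mean; case: (eqVneq s t) => [<-|neq].
    by rewrite eqxx Pdiag sum_Gamma add0n; field.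
  rewrite -val_eqE /= in neq; rewrite (negPf neq) Poff //.
  under eq_bigr do under eq_bigr do rewrite mxE.
  by rewrite !sumr_const !card_ord mulr_natl mulr_natr.
transitivity (x s / (d s)%:R * (\sum_i \sum_j submxblock P s t j i) *
              (x t / (d t)%:R)); last by rewrite sumE; field; rewrite ?dsn0 ?dtn0.
rewrite mulr_sumr mulr_suml mxE; apply: eq_bigr => i _; rewrite !mxE.
congr (_ * _); rewrite mulr_sumr; apply: eq_bigr => j _.
by rewrite [_^T _ _]mxE mxE.
Qed.

End Reduction.

(** * Correctness of a run *)

Section Correctness.
Variables (R : rcfType) (S : nat) (d : nat -> nat).
Hypothesis d_gt0 : forall s, (s < S)%N -> (0 < d s)%N.
Variables (P L : 'M[R]_(\sum_(s < S) d s)).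
Variables (dg od : nat -> nat -> R) (cr : nat -> nat -> nat -> R).
Variables (ltil l : nat -> nat -> R) (c : nat -> nat -> nat -> R).
Hypothesis run : Cholesky_run P dg od cr ltil l c L.
Hypothesis Ppsd : possemidef P.

Let run_stage_psd s : (s < S)%N -> stage_psd S d dg od cr s.
Proof.
move=> ltsS; apply: (stage_psd_all d_gt0) => // [u ltus t1 t2 ltt1 ltt2|].
  by rewrite (run_dg run) // (run_od run) // (run_cr run).
exact: (stage_psd_init d_gt0 (run_init run) Ppsd).
Qed.

Let run_pivot_psd s : (s < S)%N -> pivot_psd (d s) (dg s 0%N) (od s 0%N).
Proof. by move=> ltsS; apply: (stage_pivot_psd d_gt0) ltsS (run_stage_psd ltsS). Qed.

Let run_pivot_seq s : (s < S)%N ->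
  pivot_seq (d s) (dg s 0%N) (od s 0%N) (ltil s) (l s).
Proof. by move=> ltsS j ltjd; split; [apply: (run_ltil run) | apply: (run_l run)]. Qed.

Let run_row_seq s m : (0 < m)%N -> (s + m < S)%N ->
  row_seq (d s) (ltil s) (l s) (cr s m 0%N) (c s m).
Proof.
move=> m_gt0 ltmS j ltjd; have [l0|nz] := eqVneq (ltil s j) 0.
  by rewrite (run_c0 run) // l0 invr0 mulr0.
by rewrite -(run_c run m_gt0 ltmS ltjd) addrK mulfK.
Qed.

(** The contribution of block column [u] to the entries of [L L^T] in blocks
    [(s1, s2)], [u < s2 <= s1]; it is the same for all entries of the block. *)
Definition row_dot (s1 s2 u : nat) : R :=
  \sum_(k < d u) c u (s1 - u) k * c u (s2 - u) k.

Let row_dotE s1 s2 u : (u < s1)%N -> (s1 < S)%N -> (u < s2)%N -> (s2 < S)%N ->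
  row_dot s1 s2 u = (d u)%:R * cr u (s1 - u)%N 0%N * cr u (s2 - u)%N 0%N
    / ones_eig (d u) (dg u 0%N) (od u 0%N).
Proof.
move=> ltu1 lt1S ltu2 lt2S; have ltuS := ltn_trans ltu1 lt1S.
have [m1_gt0 m1S] : (0 < s1 - u)%N /\ (u + (s1 - u) < S)%N.
  by rewrite subn_gt0 subnKC // ltnW.
have [m2_gt0 m2S] : (0 < s2 - u)%N /\ (u + (s2 - u) < S)%N.
  by rewrite subn_gt0 subnKC // ltnW.
apply: (row_seq_dot (run_pivot_psd ltuS) (run_pivot_seq ltuS)
  (run_row_seq m1_gt0 m1S) (run_row_seq m2_gt0 m2S)).
- exact: stage_zero_pivot m1_gt0 m1S (run_stage_psd ltuS).
- exact: stage_zero_pivot m2_gt0 m2S (run_stage_psd ltuS).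
Qed.

(** Parameters of stage [0] are recovered from those of stage [n] and the
    contributions of the block columns eliminated in between. *)
Lemma unroll_schur (g h : nat -> R) n :
  (forall u, (u < n)%N -> g u.+1 = g u - h u) ->
  g 0%N = \sum_(u < n) h u + g n.
Proof.
elim: n => [|n IHn] gS; first by rewrite big_ord0 add0r.
rewrite big_ord_recr /= gS // [X in _ + X]addrC addrA addrK.
by apply: IHn => u ltun; apply: gS; apply: ltnW.
Qed.

Let shift_group s1 u : (u < s1)%N -> (s1 < S)%N ->
  (s1 - u = (s1 - u.+1).+1)%N /\ (u.+1 + (s1 - u.+1) < S)%N.
Proof. by move=> ltus lt1S; rewrite subnSK // subnKC. Qed.

(* The block of P between groups s1 and s2 has index (s1 - u, s2 - u) at
   stage u. *)
Let dg_unroll s : (s < S)%N ->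
  dg 0%N s = \sum_(u < s) row_dot s s u + dg s 0%N.
Proof.
move=> ltsS.
have := @unroll_schur (fun u => dg u (s - u)%N) (row_dot s s) s.
rewrite subn0 subnn; apply=> u ltus.
have [sE ltS] := shift_group ltus ltsS.
by rewrite row_dotE // sE (run_dg run) // expr2 mulrA.
Qed.

Let od_unroll s : (s < S)%N ->
  od 0%N s = \sum_(u < s) row_dot s s u + od s 0%N.
Proof.
move=> ltsS.
have := @unroll_schur (fun u => od u (s - u)%N) (row_dot s s) s.
rewrite subn0 subnn; apply=> u ltus.
have [sE ltS] := shift_group ltus ltsS.
by rewrite row_dotE // sE (run_od run) // expr2 mulrA.
Qed.

Let cr_unroll s1 s2 : (s2 < s1)%N -> (s1 < S)%N ->
  cr 0%N s1 s2 = \sum_(u < s2) row_dot s1 s2 u + cr s2 (s1 - s2)%N 0%N.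
Proof.
move=> lt21 lt1S.
have := @unroll_schur (fun u => cr u (s1 - u)%N (s2 - u)%N) (row_dot s1 s2) s2.
rewrite !subn0 subnn; apply=> u ltu2.
have ltu1 := ltn_trans ltu2 lt21; have lt2S := ltn_trans lt21 lt1S.
have [s1E lt1S'] := shift_group ltu1 lt1S.
have [s2E lt2S'] := shift_group ltu2 lt2S.
by rewrite row_dotE // s1E s2E (run_cr run).
Qed.

(** Product of a row with a row of the triangular pivot factor. *)
Let pivot_row_dot (s : 'I_S) (v : nat -> R) (j : 'I_(d s)) :
  \sum_(k < d s) v k * submxblock L s s j k =
  v j * ltil s j + \sum_(k < j) v k * l s k.
Proof.
rewrite (run_L_diag run) (bigD1 j) //= mxE ltnn eqxx; congr (_ + _).
rewrite (big_ord_widen (d s) (fun k => v k * l s k) (ltnW (ltn_ord j))).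
rewrite big_mkcond [RHS]big_mkcond; apply: eq_bigr => k _ /=; rewrite mxE.
by rewrite -val_eqE /= -[j == k]val_eqE /=; case: ltngtP => //; rewrite mulr0.
Qed.

Let factor_entry (s1 s2 : 'I_S) (i : 'I_(d s1)) (j : 'I_(d s2)) :
  (s2 <= s1)%N ->
  submxblock (L *m L^T) s1 s2 i j = \sum_(u < s2) row_dot s1 s2 u
    + \sum_k submxblock L s1 s2 i k * submxblock L s2 s2 j k.
Proof.
move=> le21.
rewrite -{1 2}[L]submxblockK tr_mxblock mul_mxblock mxblockK summxE.
rewrite (bigD1 s2) //= addrC; congr (_ + _); last first.
  by rewrite mxE; apply: eq_bigr => k _; rewrite [_^T _ _]mxE.
rewrite (big_ord_widen S (row_dot s1 s2) (ltnW (ltn_ord s2))).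
rewrite big_mkcond [RHS]big_mkcond; apply: eq_bigr => u _ /=.
rewrite -val_eqE /=; case: ltngtP => //= [ltu2|lt2u].
  rewrite mxE /row_dot; apply: eq_bigr => k _.
  by rewrite [_^T _ _]mxE !(run_L_lower run) ?(leq_trans ltu2) // !mxE.
by rewrite (run_L_upper run lt2u) trmx0 mulmx0 mxE.
Qed.

Let factor_diag_entry (s : 'I_S) (i j : 'I_(d s)) : (j <= i)%N ->
  Gamma (d s) (dg 0%N s) (od 0%N s) i j = submxblock (L *m L^T) s s i j.
Proof.
move=> leji; rewrite factor_entry // !mxE.
pose v k : R := if (i < k)%N then 0 else if i == k :> nat then ltil s k else l s k.
have -> : \sum_(k < d s) submxblock L s s i k * submxblock L s s j k =
    \sum_(k < d s) v k * submxblock L s s j k.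
  by apply: eq_bigr => k _; rewrite {1}(run_L_diag run) mxE.
rewrite pivot_row_dot.
have -> : \sum_(k < j) v k * l s k = \sum_(k < j) l s k ^+ 2.
  apply: eq_bigr => k _; have ltki := leq_trans (ltn_ord k) leji.
  by rewrite /v ltnNge (ltnW ltki) /= gtn_eqF.
have [sq mul] := pivot_factor (run_pivot_psd (ltn_ord s)) (run_pivot_seq (ltn_ord s)).
rewrite /v ltnNge leji /= val_eqE; have [<-|neq] := eqVneq i j.
  by rewrite -expr2 sq // mulr1n !subrK dg_unroll.
have ltji : (j < i)%N by rewrite ltn_neqAle leji andbT eq_sym.
rewrite mul ?(leq_ltn_trans ltji) // subrK mulr0n add0r.
exact: od_unroll.
Qed.

Lemma Cholesky_run_factor : P = L *m L^T.
Proof.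
have [Pdiag Poff] := run_init run; have [Psym _] := Ppsd.
have main (s1 s2 : 'I_S) : (s2 <= s1)%N ->
    submxblock P s1 s2 = submxblock (L *m L^T) s1 s2.
  move=> le21; apply/matrixP => i j.
  have [e|neq] := eqVneq s1 s2.
    subst s2; rewrite Pdiag.
    have [leji|/ltnW leij] := leqP j i; first exact: factor_diag_entry.
    transitivity (Gamma (d s1) (dg 0%N s1) (od 0%N s1) j i).
      by rewrite !mxE eq_sym.
    rewrite factor_diag_entry // !factor_entry //; congr (_ + _).
    by apply: eq_bigr => k _; rewrite mulrC.
  have lt21 : (s2 < s1)%N by rewrite ltn_neqAle le21 andbT eq_sym.
  rewrite Poff // factor_entry // mxE cr_unroll //; congr (_ + _).
  have m_gt0 : (0 < s1 - s2)%N by rewrite subn_gt0.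
  have mS : (s2 + (s1 - s2) < S)%N by rewrite subnKC.
  rewrite -(run_c run m_gt0 mS (ltn_ord j)) -pivot_row_dot.
  apply: eq_bigr => k _.
  by rewrite [submxblock L s1 s2](run_L_lower run) // mxE.
apply/mxblockP => s1 s2; have [le21|/ltnW le12] := leqP s2 s1; first exact: main.
by apply: trmx_inj; rewrite !tr_submxblock Psym trmx_mul trmxK main.
Qed.

Let diag_entry (i : 'I_(\sum_(s < S) d s)) :
  exists s j, [/\ (s < S)%N, (j < d s)%N & L i i = ltil s j].
Proof.
exists (tagnat.sig1 i), (tagnat.sig2 i); split; [exact: ltn_ord | exact: ltn_ord |].
have := run_L_diag run (tagnat.sig1 i).
move=> /matrixP /(_ (tagnat.sig2 i) (tagnat.sig2 i)).
by rewrite !mxE tagnat.sig2K ltnn eqxx.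
Qed.

Lemma Cholesky_run_correct : is_Cholesky_factor P L.
Proof.
have Ltrig : is_trig_mx L.
  rewrite -[L]submxblockK; apply/is_trig_mxblockP; split=> [i j|i].
    exact: (run_L_upper run).
  by rewrite (run_L_diag run); apply/is_trig_mxP => j k ltjk; rewrite mxE ltjk.
have Lge0 i : 0 <= L i i.
  by have [s [j [ltsS ltjd ->]]] := diag_entry i; rewrite (run_ltil run) ?sqrtr_ge0.
split=> //; last exact: Cholesky_run_factor.
(* A zero on the diagonal gives v <> 0 with v L = 0, hence v P v^T = 0. *)
move=> [_ Ppos] i; rewrite lt_def Lge0 andbT; apply: contraTneq isT => Lii0.
have : \det L == 0.
  by rewrite det_trig // (bigD1 i) //= Lii0 mul0r.
move=> /det0P [v vn0 vL].
have : v^T != 0 by rewrite -trmx0 (inj_eq trmx_inj).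
move=> /Ppos; rewrite trmxK Cholesky_run_factor.
by rewrite !mulmxA vL !mul0mx mxE ltxx.
Qed.

End Correctness.

(** * Existence of a run *)

Section Execution.
Variable R : rcfType.

(** The partial sums of the squares of the entries [l], computed recursively. *)
Fixpoint pivot_sum (a b : R) (j : nat) : R :=
  if j is k.+1 then
    let q := pivot_sum a b k in q + (1 / Num.sqrt (a - q) * (b - q)) ^+ 2
  else 0.

(** The diagonal and subdiagonal entries of the factor of a pivot block. *)
Definition pivot_ltil (a b : R) (j : nat) : R := Num.sqrt (a - pivot_sum a b j).

Definition pivot_l (a b : R) (j : nat) : R :=
  1 / pivot_ltil a b j * (b - pivot_sum a b j).

Lemma pivot_sumE a b j : \sum_(k < j) pivot_l a b k ^+ 2 = pivot_sum a b j.
Proof. by elim: j => [|j IHj]; rewrite ?big_ord0 // big_ord_recr IHj. Qed.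

Lemma pivot_seq_exec n a b : pivot_seq n a b (pivot_ltil a b) (pivot_l a b).
Proof. by move=> j _; rewrite pivot_sumE. Qed.

(** The partial sums of [c k * l k], computed recursively. *)
Fixpoint row_sum (ltil l : nat -> R) (r : R) (j : nat) : R :=
  if j is k.+1 then
    let w := row_sum ltil l r k in w + (r - w) / ltil k * l k
  else 0.

(** The solution [c] of the triangular equations, by forward substitution. *)
Definition row_c ltil l r (j : nat) : R := (r - row_sum ltil l r j) / ltil j.

Lemma row_seq_exec n ltil l r : row_seq n ltil l r (row_c ltil l r).
Proof.
suff sumE j : \sum_(k < j) row_c ltil l r k * l k = row_sum ltil l r j.
  by move=> j _; rewrite sumE.
by elim: j => [|j IHj]; rewrite ?big_ord0 // big_ord_recr IHj.
Qed.

(** The parameters of one stage, relative to its pivot group. *)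
Record stage := Stage {
  stage_dg : nat -> R;
  stage_od : nat -> R;
  stage_cr : nat -> nat -> R
}.

(** The parameters after eliminating a pivot group of size [n]. *)
Definition next_stage (n : nat) (x : stage) : stage :=
  let D := stage_dg x 0%N + (n%:R - 1) * stage_od x 0%N in
  {| stage_dg := fun t =>
       stage_dg x t.+1 - n%:R * stage_cr x t.+1 0%N ^+ 2 / D;
     stage_od := fun t =>
       stage_od x t.+1 - n%:R * stage_cr x t.+1 0%N ^+ 2 / D;
     stage_cr := fun t1 t2 =>
       stage_cr x t1.+1 t2.+1
         - n%:R * stage_cr x t1.+1 0%N * stage_cr x t2.+1 0%N / D |}.

(** The successive parameters, starting from [x]. *)
Fixpoint stages (d : nat -> nat) (x : stage) (s : nat) : stage :=
  if s is u.+1 then next_stage (d u) (stages d x u) else x.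

(** Semi-definiteness is needed for the defining equations of [c] at the
    indices where [ltil] vanishes. *)
Lemma Cholesky_run_exists (S : nat) (d : nat -> nat)
    (P : 'M[R]_(\sum_(s < S) d s)) (x : stage) :
  (forall s, (s < S)%N -> (0 < d s)%N) ->
  has_block_form (stage_dg x) (stage_od x) (stage_cr x) P ->
  possemidef P -> exists L, algorithm_returns P L.
Proof.
move=> d_gt0 Pform Ppsd.
pose dg s := stage_dg (stages d x s); pose od s := stage_od (stages d x s).
pose cr s := stage_cr (stages d x s).
pose ltil s := pivot_ltil (dg s 0%N) (od s 0%N).
pose l s := pivot_l (dg s 0%N) (od s 0%N).
pose c s m := row_c (ltil s) (l s) (cr s m 0%N).
pose B (s1 s2 : 'I_S) : 'M[R]_(d s1, d s2) := \matrix_(i, j)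
  if (s1 < s2)%N then 0 else
  if (s2 < s1)%N then c s2 (s1 - s2)%N j else
  if (i < j)%N then 0 else
  if i == j :> nat then ltil s2 j else l s2 j.
have psd s : (s < S)%N -> stage_psd S d dg od cr s.
  move=> ltsS; apply: (stage_psd_all d_gt0) => //.
  exact: (stage_psd_init d_gt0 Pform Ppsd).
have piv s : pivot_seq (d s) (dg s 0%N) (od s 0%N) (ltil s) (l s).
  exact: pivot_seq_exec.
have row s m : row_seq (d s) (ltil s) (l s) (cr s m 0%N) (c s m).
  exact: row_seq_exec.
exists (\mxblock_(s1, s2) B s1 s2), dg, od, cr, ltil, l, c; split=> //.
- by move=> s j _ ltjd; have [] := piv s j ltjd.
- by move=> s j _ ltjd; have [] := piv s j ltjd.
- move=> s m j m_gt0 ltmS ltjd.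
  have ltsS : (s < S)%N by apply: leq_ltn_trans ltmS; apply: leq_addr.
  apply: row_seq_solves (stage_pivot_psd d_gt0 ltsS (psd s ltsS)) _ _ _ j ltjd => //.
  exact: stage_zero_pivot (psd s ltsS).
- by move=> s m j m_gt0 ltmS ltjd l0; rewrite (row s m) // l0 invr0 mulr0.
- by move=> s; rewrite mxblockK; apply/matrixP => i j; rewrite !mxE ltnn.
- move=> s1 s2 lt21; rewrite mxblockK; apply/matrixP => i j.
  by rewrite !mxE ltnNge (ltnW lt21) /= lt21.
- move=> s1 s2 lt12; rewrite mxblockK; apply/matrixP => i j.
  by rewrite !mxE lt12.
Qed.

End Execution.

Theorem mainTheorem7 (R : rcfType) (S : nat) (d : nat -> nat)
    (P : 'M[R]_(\sum_(s < S) d s)) :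
  (0 < S)%N -> (forall s, (s < S)%N -> (0 < d s)%N) ->
  block_homogeneous_correlation P ->
  (exists L : 'M[R]_(\sum_(s < S) d s), algorithm_returns P L) /\
  (forall L : 'M[R]_(\sum_(s < S) d s),
     algorithm_returns P L -> is_Cholesky_factor P L).
Proof.
move=> _ d_gt0 [[_ _ _ [rho _ Pform]] Ppsd]; split.
  exact: (@Cholesky_run_exists R S d P (Stage _ _ _) d_gt0 Pform Ppsd).
by move=> L [dg [od [cr [ltil [l [c run]]]]]]; exact: Cholesky_run_correct run Ppsd.
Qed.
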